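(* The optimal Halpern iteration for linear maps is obtained by choosing the stepsizes $\beta_n=\frac{n}{n+1}$. That is, for every $n\ge1$ the choice $\beta_k=\frac{k}{k+1}$ minimizes the worst-case constant $W_n(\beta)$ among all stepsize sequences $\beta$, and attains the value $W_n=\frac{2}{n+1}$; so with this choice one has the tight bound $$\|x^n-Tx^n\|\le\frac{2\|x^0-x^*\|}{n+1},\qquad\forall n\ge1,$$ for every linear non-expansive map $T:X\to X$ on a normed space $X$, every $x^*\in\operatorname{Fix}(T)$, and every initial point $x^0=y^0\in X$. With this choice the iterates are given by $$x^n=\frac{1}{n+1}x^0+\frac{n}{n+1}Tx^{n-1}=\frac{1}{n+1}\sum_{k=0}^nT^kx^0.$$
   Context: Given a stepsize sequence $\beta=(\beta_n)_{n\ge0}$ in $[0,1]$ with $\beta_0=0$, a linear non-expansive map $T:X\to X$ (i.e. $\|Tx-Ty\|\le\|x-y\|$ for all $x,y\in X$) on a normed space $X$, and an initial point $x^0=y^0\in X$, Halpern's iteration is $x^n=(1-\beta_n)y^0+\beta_nTx^{n-1}$ for $n\ge1$. The worst-case constant is $$W_n(\beta)=\sup\frac{\|x^n-Tx^n\|}{\|x^0-x^*\|},$$ the supremum being over all normed spaces $X$, all linear non-expansive maps $T:X\to X$, all $x^*\in\operatorname{Fix}(T)$ (the set of fixed points), and all initial points $x^0=y^0\in X$ with $x^0\ne x^*$. *)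

(* Defs.v *)
From HB Require Import structures.
From mathcomp Require Import all_boot all_order all_algebra.
From mathcomp Require Import all_classical all_reals all_analysis.
Import Order.TTheory GRing.Theory Num.Theory.
Import numFieldNormedType.Exports.

Set Implicit Arguments.
Unset Strict Implicit.
Unset Printing Implicit Defensive.

Local Open Scope classical_set_scope.
Local Open Scope ring_scope.

Definition stepsize (R : realType) (beta : nat -> R) : Prop :=
  beta 0%N = 0 /\ forall n, 0 <= beta n <= 1.

Definition nonexpansive (R : realType) (X : normedModType R) (T : X -> X) :
    Prop :=
  forall x y : X, `|T x - T y| <= `|x - y|.

Definition Fix (X : Type) (T : X -> X) : set X := [set x | T x = x].

(* The anchor y^0 of the iteration is the initial point x^0 itself. *)
Fixpoint halpern (R : realType) (X : normedModType R) (beta : nat -> R)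
    (T : X -> X) (x0 : X) (n : nat) : X :=
  match n with
  | 0%N => x0
  | m.+1 => (1 - beta m.+1) *: x0 + beta m.+1 *: T (halpern beta T x0 m)
  end.

(* The supremum is taken in the extended reals, so that it always exists;
   existentially quantifying over X inside the set makes it range over all
   normed spaces over R. *)
Definition worst_case (R : realType) (n : nat) (beta : nat -> R) : \bar R :=
  ereal_sup [set r : \bar R |
    exists (X : normedModType R) (T : {linear X -> X}) (xs x0 : X),
      [/\ nonexpansive T, Fix T xs, x0 <> xs &
        r = (`|halpern beta T x0 n - T (halpern beta T x0 n)|
               / `|x0 - xs|)%:E]].

Definition beta_opt (R : realType) (n : nat) : R := n%:R / n.+1%:R.

(* Main.v *)
Require Import Defs.
From HB Require Import structures.
From mathcomp Require Import all_boot all_order all_algebra.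
From mathcomp Require Import all_classical all_reals all_analysis.
Import Order.TTheory GRing.Theory Num.Theory.
Import numFieldNormedType.Exports.

Set Implicit Arguments.
Unset Strict Implicit.
Unset Printing Implicit Defensive.

Local Open Scope classical_set_scope.
Local Open Scope ring_scope.

(** Unrolling the recursion writes the iterate as
      x^n = sum_(k <= n) c_k T^k x^0,
    where the coefficients c_k depend only on the stepsizes and add up to 1.
    Both bounds are read off from this expansion.

    Upper bound.  The stepsizes k / (k + 1) make all the c_k equal to
    1 / (n + 1), so that x^n is an ergodic average of the orbit and
    x^n - T x^n telescopes to (x^0 - T^(n+1) x^0) / (n + 1).  As T^(n+1) moves
    x^0 no farther away from a fixed point, this has norm at most
    2 |x^0 - x*| / (n + 1) ([norm_halpern_residual_le]).

    Lower bound.  Whatever the stepsizes, some coefficient c_m is at least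
    the mean 1 / (n + 1).  On a space of sequences with the sup norm, let T be
    the left shift, which has 0 as a fixed point, and start from the sequence
    s of norm 1 equal to 1 up to index m and to -1 afterwards.  The first entry
    of x^n - T x^n is sum_k c_k (s_k - s_(k+1)), in which only the jump of s
    at m survives, leaving 2 c_m ([worst_case_ge]).  Finitely many entries
    suffice, since only s_0, ..., s_(n+1) are ever looked at. *)

(** * Expansion of the iterates along the orbit *)

(** The coefficient of [iter k T x0] in the iterate of index [n].  It is the
    same for all spaces and maps, so the map that witnesses the lower bound can
    be chosen once the coefficients are known. *)
Fixpoint halpern_coef (R : realType) (beta : nat -> R) (n k : nat) : R :=
  match n, k with
  | 0%N, 0%N => 1
  | 0%N, _.+1 => 0
  | _.+1, 0%N => 1 - beta n
  | n'.+1, k'.+1 => beta n * halpern_coef beta n' k'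
  end.

Lemma halpernE (R : realType) (X : normedModType R) (beta : nat -> R)
    (T : {linear X -> X}) (x0 : X) (n : nat) :
  halpern beta T x0 n
    = \sum_(0 <= k < n.+1) halpern_coef beta n k *: iter k T x0.
Proof.
elim: n => [|n IHn] /=; first by rewrite big_nat1 scale1r.
rewrite big_nat_recl // IHn linear_sum scaler_sumr; congr (_ + _).
by apply: eq_bigr => k _ /=; rewrite linearZ scalerA.
Qed.

Lemma sum_halpern_coef (R : realType) (beta : nat -> R) (n : nat) :
  \sum_(0 <= k < n.+1) halpern_coef beta n k = 1.
Proof.
elim: n => [|n IHn]; first by rewrite big_nat1.
by rewrite big_nat_recl //= -mulr_sumr IHn mulr1 subrK.
Qed.

Lemma halpern_coef_ge_mean (R : realType) (beta : nat -> R) (n : nat) :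
  exists2 m : nat, (m <= n)%N & n.+1%:R^-1 <= halpern_coef beta n m.
Proof.
apply: contrapT => small.
have : \sum_(0 <= k < n.+1) halpern_coef beta n k
         < \sum_(0 <= k < n.+1) (n.+1%:R^-1 : R).
  apply: ltr_sum_nat => // k /andP[_ lekn].
  by rewrite ltNge; apply/negP => gek; apply: small; exists k.
by rewrite sum_halpern_coef sumr_const_nat subn0 -[ltRHS]mulr_natr mulVf ?ltxx.
Qed.

(** * The upper bound for the averaging stepsizes *)

Lemma stepsize_beta_opt (R : realType) : stepsize (@beta_opt R).
Proof.
split=> [|n]; first by rewrite /beta_opt mul0r.
rewrite /beta_opt divr_ge0 ?ler0n //=.
by rewrite ler_pdivrMr ?ltr0n // mul1r ler_nat.
Qed.

Lemma beta_opt_compl (R : realType) (n : nat) :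
  1 - beta_opt R n = n.+1%:R^-1.
Proof.
have n1_neq0 : n.+1%:R != 0 :> R by rewrite pnatr_eq0.
by rewrite /beta_opt -[X in X - _](divff n1_neq0) -mulrBl -natr1 addrC addKr mul1r.
Qed.

(** The product of the stepsizes used after step [n - k] telescopes
    to (n - k + 1) / (n + 1), which cancels the weight 1 / (n - k + 1) with
    which the anchor enters at step [n - k]. *)
Lemma halpern_coef_beta_opt (R : realType) (n k : nat) :
  (k <= n)%N -> halpern_coef (@beta_opt R) n k = n.+1%:R^-1.
Proof.
elim: n k => [|n IHn] [|k] //= lekn; first by rewrite invr1.
  by rewrite beta_opt_compl.
by rewrite IHn // /beta_opt mulrAC divff ?mul1r // pnatr_eq0.
Qed.

Lemma halpern_beta_optE (R : realType) (X : normedModType R)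
    (T : {linear X -> X}) (x0 : X) (n : nat) :
  halpern (@beta_opt R) T x0 n
    = n.+1%:R^-1 *: \sum_(0 <= k < n.+1) iter k T x0.
Proof.
rewrite halpernE scaler_sumr; apply: eq_big_nat => k /andP[_ lekn].
by rewrite halpern_coef_beta_opt.
Qed.

Lemma halpern_beta_opt_residual (R : realType) (X : normedModType R)
    (T : {linear X -> X}) (x0 : X) (n : nat) :
  halpern (@beta_opt R) T x0 n - T (halpern (@beta_opt R) T x0 n)
    = n.+1%:R^-1 *: (x0 - iter n.+1 T x0).
Proof.
rewrite halpern_beta_optE linearZ linear_sum -scalerBr -sumrB.
congr (_ *: _); rewrite -[RHS]opprB.
have /= <- := telescope_sumr (fun k => iter k T x0) (leq0n n.+1).
by rewrite -sumrN; apply: eq_bigr => k _; rewrite opprB.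
Qed.

Lemma dist_iter_Fix (R : realType) (X : normedModType R) (T : X -> X)
    (xs x : X) (n : nat) :
  nonexpansive T -> Fix T xs -> `|iter n T x - xs| <= `|x - xs|.
Proof.
move=> neT fixT; elim: n => //= n IHn.
by rewrite -[X in _ - X]fixT; apply: le_trans (neT _ _) IHn.
Qed.

Lemma norm_halpern_residual_le (R : realType) (X : normedModType R)
    (T : {linear X -> X}) (xs x0 : X) (n : nat) :
  nonexpansive T -> Fix T xs ->
  `|halpern (@beta_opt R) T x0 n - T (halpern (@beta_opt R) T x0 n)|
    <= 2 * `|x0 - xs| / n.+1%:R.
Proof.
move=> neT fixT; rewrite halpern_beta_opt_residual normrZ ger0_norm ?invr_ge0 //.
rewrite [leRHS]mulrC ler_wpM2l ?invr_ge0 // mulr_natl mulr2n.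
apply: le_trans (ler_distD xs _ _) _; rewrite lerD2l distrC.
exact: dist_iter_Fix.
Qed.

(** * The lower bound: a shift on a sup-normed space *)

Lemma norm_row_entry_le (R : realType) (n : nat) (x : 'rV[R]_n.+1)
    (i : 'I_n.+1) : `|x 0 i| <= `|x|.
Proof.
rewrite [leRHS]mx_normrE.
exact: (le_bigmax _ (fun ij : 'I_1 * 'I_n.+1 => `|x ij.1 ij.2|) (0, i)).
Qed.

Lemma norm_row_le (R : realType) (n : nat) (x : 'rV[R]_n.+1) (c : R) :
  0 <= c -> (forall i, `|x 0 i| <= c) -> `|x| <= c.
Proof.
move=> c_ge0 xc; rewrite [leLHS]mx_normrE; apply: bigmax_le => // -[i j] _ /=.
by rewrite ord1.
Qed.

(** The left shift.  At the last index [inord] falls back to index 0, so every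
    entry of the image is an entry of the argument; this is what makes the map
    nonexpansive for the sup norm. *)
Definition shift_row (R : realType) (n : nat) :
    {linear 'rV[R]_n.+1 -> 'rV[R]_n.+1} :=
  colsub (fun i : 'I_n.+1 => inord i.+1).

Lemma nonexpansive_shift_row (R : realType) (n : nat) :
  nonexpansive (shift_row R n).
Proof.
move=> x y; rewrite -linearB; apply: norm_row_le => // i.
by rewrite !mxE -[X in `|X|](_ : (x - y) 0 (inord i.+1) = _) ?norm_row_entry_le ?mxE.
Qed.

Lemma iter_shift_row0 (R : realType) (n : nat) (x : 'rV[R]_n.+1) (k : nat) :
  (k <= n)%N -> iter k (shift_row R n) x 0 0 = x 0 (inord k).
Proof.
move=> lekn; suff shiftE (j : nat) : (k + j <= n)%N ->
    iter k (shift_row R n) x 0 (inord j) = x 0 (inord (k + j)).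
  by rewrite -[k in RHS]addn0 -shiftE ?addn0 //; congr (_ 0 _); apply: val_inj;
     rewrite /= inordK.
elim: k {lekn} j => [//|k IHk] j lekjn /=; rewrite mxE.
rewrite inordK ?IHk -?addSnnS //.
by rewrite ltnS (leq_trans _ lekjn) // leq_addl.
Qed.

(** The functional [x |-> x 0 0] turns the sum along the orbit into a sum of
    entries of the starting point. *)
Lemma halpern_shift_residual0 (R : realType) (beta : nat -> R) (n : nat)
    (x : 'rV[R]_n.+2) :
  let y := halpern beta (shift_row R n.+1) x n in
  (y - shift_row R n.+1 y) 0 0
    = \sum_(0 <= k < n.+1)
        halpern_coef beta n k * (x 0 (inord k) - x 0 (inord k.+1)).
Proof.
rewrite /= halpernE linear_sum -sumrB summxE; apply: eq_big_nat => k /andP[_ lekn].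
rewrite linearZ -scalerBr -iterS mxE; congr (_ * _).
by rewrite [LHS]mxE [X in _ + X]mxE !iter_shift_row0 // ltnW.
Qed.

(** Equal to 1 up to index [m] and to -1 afterwards. *)
Definition step_row (R : realType) (n m : nat) : 'rV[R]_n.+1 :=
  \row_i (if (i <= m)%N then 1 else -1).

Lemma norm_step_row (R : realType) (n m : nat) : `|step_row R n m| = 1.
Proof.
apply/eqP; rewrite eq_le; apply/andP; split.
  by apply: norm_row_le => // i; rewrite mxE; case: ifP; rewrite ?normrN normr1.
by have := norm_row_entry_le (step_row R n m) 0; rewrite mxE leq0n normr1.
Qed.

Lemma step_row_jump (R : realType) (n m k : nat) : (k < n)%N ->
  step_row R n m 0 (inord k) - step_row R n m 0 (inord k.+1)
    = if k == m then 2 else 0.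
Proof.
move=> ltkn; rewrite !mxE !inordK ?ltnS //; last exact: ltnW.
by case: ltngtP => _; rewrite ?subrr // opprK -mulr2n.
Qed.

(** The jump of the starting point is placed at an index [m] carrying at least
    the mean of the coefficients, which sum to 1 over [n.+1] indices. *)
Lemma worst_case_ge (R : realType) (beta : nat -> R) (n : nat) :
  ((2 / n.+1%:R)%:E <= worst_case n beta)%E.
Proof.
have [m lemn gem] := halpern_coef_ge_mean beta n.
pose s := step_row R n.+1 m; pose y := halpern beta (shift_row R n.+1) s n.
apply: (@le_trans _ _ (`|y - shift_row R n.+1 y| / `|s - 0|)%:E); last first.
  apply: ereal_sup_ubound; exists 'rV[R]_n.+2, (shift_row R n.+1), 0, s.
  split=> //; first exact: nonexpansive_shift_row.
    by rewrite /Fix /= linear0.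
  move=> s0; have := norm_step_row R n.+1 m; rewrite -/s s0 normr0.
  by move/esym/eqP; rewrite oner_eq0.
rewrite subr0 norm_step_row divr1 lee_fin.
apply: le_trans (norm_row_entry_le _ 0); apply: le_trans (ler_norm _).
rewrite halpern_shift_residual0.
under eq_big_nat => k /andP[_ lekn] do rewrite step_row_jump //.
rewrite (bigD1_seq m) ?mem_index_iota ?iota_uniq //= eqxx big1 ?addr0.
  by rewrite mulrC ler_wpM2r.
by move=> k /negPf->; rewrite mulr0.
Qed.

(** * Optimality *)

Lemma worst_case_beta_opt (R : realType) (n : nat) :
  worst_case n (@beta_opt R) = (2 / n.+1%:R)%:E.
Proof.
apply/eqP; rewrite eq_le worst_case_ge andbT; apply: ge_ereal_sup.
move=> _ [X [T [xs [x0 [neT fixT x0xs ->]]]]]; rewrite lee_fin.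
rewrite ler_pdivrMr ?normr_gt0 ?subr_eq0; last exact/eqP.
by rewrite mulrAC; apply: norm_halpern_residual_le.
Qed.

Theorem theorem4p6 (R : realType) :
  [/\ stepsize (@beta_opt R),
      (forall (n : nat), (1 <= n)%N ->
        (forall beta : nat -> R, stepsize beta ->
           (worst_case n (@beta_opt R) <= worst_case n beta)%E) /\
        worst_case n (@beta_opt R) = (2 / n.+1%:R)%:E),
      (forall (X : normedModType R) (T : {linear X -> X}) (xs x0 : X),
        nonexpansive T -> Fix T xs ->
        forall n : nat, (1 <= n)%N ->
          `|halpern (@beta_opt R) T x0 n - T (halpern (@beta_opt R) T x0 n)|
            <= 2 * `|x0 - xs| / n.+1%:R) &
      (forall (X : normedModType R) (T : {linear X -> X}) (x0 : X),
        nonexpansive T ->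
        forall n : nat, (1 <= n)%N ->
          halpern (@beta_opt R) T x0 n
            = n.+1%:R^-1 *: x0
              + (n%:R / n.+1%:R) *: T (halpern (@beta_opt R) T x0 n.-1) /\
          halpern (@beta_opt R) T x0 n
            = n.+1%:R^-1 *: \sum_(0 <= k < n.+1) iter k T x0)].
Proof.
split.
- exact: stepsize_beta_opt.
- move=> n _; split=> [beta _|]; last exact: worst_case_beta_opt.
  by rewrite worst_case_beta_opt; apply: worst_case_ge.
- by move=> X T xs x0 neT fixT n _; apply: norm_halpern_residual_le.
- move=> X T x0 _ [//|n] _; split; last exact: halpern_beta_optE.
  by rewrite /= beta_opt_compl.
Qed.
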